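(* The compatibility conditions, i.e. the component equations of Cartan's structure equation $d\Omega+\Omega\wedge\Omega=0$ for the moving frame of a regular elliptical surface, are given by the following system (that is, for $\Omega$ given by the formulas in the context, $d\Omega+\Omega\wedge\Omega=0$ is equivalent to this system): $$36\mathrm{D}^2I_{31}-36\mathrm{D}^1I_{22}-12\mathrm{D}^2I_{13}+12\mathrm{D}^1I_{04}-9I_{40}I_{22}+3I_{40}I_{04}-24I_{31}I_{13}+18I_{22}^2-3I_{22}I_{04}+8I_{13}^2-I_{04}^2-18I_{40}-36I_{22}-18I_{04}=0,$$ $$12\mathrm{D}^2I_{40}-12\mathrm{D}^1I_{31}+12\mathrm{D}^2I_{22}-12\mathrm{D}^1I_{13}-3I_{40}I_{31}-23I_{40}I_{13}+18I_{31}I_{22}+5I_{31}I_{04}-6I_{22}I_{13}+I_{13}I_{04}+48I_{13}=0,$$ $$12\mathrm{D}^2I_{31}-12\mathrm{D}^1I_{22}+12\mathrm{D}^2I_{13}-12\mathrm{D}^1I_{04}-3I_{40}I_{22}-7I_{40}I_{04}-16I_{31}I_{13}+18I_{22}^2+15I_{22}I_{04}-16I_{13}^2+I_{04}^2+18I_{40}-36I_{22}-6I_{04}=0,$$ $$12\mathrm{D}^2I_{40}-12\mathrm{D}^1I_{31}-36\mathrm{D}^2I_{22}+36\mathrm{D}^1I_{13}-3I_{40}I_{31}+I_{40}I_{13}+6I_{31}I_{22}+I_{31}I_{04}+6I_{22}I_{13}-3I_{13}I_{04}=0,$$ $$dw_1=Y_1\,w_1\wedge w_2,\qquad dw_2=Y_2\,w_1\wedge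 w_2,$$ where $Y_1=\frac{2I_{13}}{3}$ and $Y_2=\frac{I_{40}}{4}-\frac{I_{22}}{2}-\frac{I_{04}}{12}$.
   Context: A smooth surface $S$ in real affine 3-space is regular elliptical if at every $P\in S$ there is an affine frame $(e_1,e_2,e_3)$ with origin $P$ such that in the coordinates $(x,y,z)\leftrightarrow P+xe_1+ye_2+ze_3$ the surface is near $P$ a graph $z=\frac12(x^2+y^2)+\frac16(x^3-3xy^2)+\sum_{n\ge4}\frac1{n!}\sum_{i+j=n}I_{ij}\binom nix^iy^j$. Choosing such frames smoothly gives a moving frame $(e_1,e_2,e_3,r)$ ($r$ the position vector), 1-forms $w_1,w_2$ (a coframe on $S$) with $dr=w_1e_1+w_2e_2$, and functions $I_{ij}$ on $S$. The operators $\mathrm{D}^1,\mathrm{D}^2$ are defined by $df=\mathrm{D}^1f\,w_1+\mathrm{D}^2f\,w_2$. The moving equation is $d(e_1,e_2,e_3,r)=(e_1,e_2,e_3,r)\Omega$ with $$\Omega=\begin{pmatrix} w_{11} & w_{12} & w_{13} & w_1 \\ w_{21} & w_{22} & w_{23} & w_2 \\ w_{31} & w_{32} & w_{33} & 0 \\ 0 & 0 & 0 & 0 \end{pmatrix},\qquad w_{ij}=R_{ij}^1w_1+R_{ij}^2w_2,$$ where $$(R^1_{ij})=\begin{pmatrix}-\frac{I_{40}}4+\frac{3I_{22}}4-\frac12&-\frac{I_{31}}4+\frac{I_{13}}{12}&-\frac{I_{40}}4-\frac{I_{22}}4+\frac12 \\ \frac{I_{31}}4-\frac{I_{13}}{12}&-\frac{I_{40}}4+\frac{3I_{22}}4+\frac12&-\frac{I_{31}}4-\frac{I_{13}}4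 \\ 1&0&-\frac{I_{40}}2+\frac{3I_{22}}2\end{pmatrix},$$ $$(R^2_{ij})=\begin{pmatrix}-\frac{I_{31}}4+\frac{3I_{13}}4&-\frac{I_{22}}4+\frac{I_{04}}{12}+\frac12&-\frac{I_{31}}4-\frac{I_{13}}4 \\ \frac{I_{22}}4-\frac{I_{04}}{12}+\frac12&-\frac{I_{31}}4+\frac{3I_{13}}4&-\frac{I_{22}}4-\frac{I_{04}}4+\frac12 \\ 0&1&-\frac{I_{31}}2+\frac{3I_{13}}2\end{pmatrix}.$$ In the equivalence, $w_1,w_2$ is any coframe on a 2-manifold and $I_{40},I_{31},I_{22},I_{13},I_{04}$ are any smooth functions on it. *)

(* Defs.v *)
From HB Require Import structures.
From mathcomp Require Import all_boot all_order all_algebra.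
From mathcomp Require Import all_classical all_reals all_analysis.

Set Implicit Arguments.
Unset Strict Implicit.
Unset Printing Implicit Defensive.

Import Order.TTheory GRing.Theory Num.Theory.
Import numFieldNormedType.Exports.

Local Open Scope classical_set_scope.
Local Open Scope ring_scope.

(* Smooth functions on open subsets of R^2 (row vectors) *)

Definition partial (R : realType) (k : 'I_2) (f : 'rV[R]_2 -> R) :
  'rV[R]_2 -> R := fun x => 'D_(delta_mx 0 k) f x.

Fixpoint Ck_on (R : realType) (n : nat) (U : set 'rV[R]_2)
    (f : 'rV[R]_2 -> R) : Prop :=
  match n with
  | 0 => forall x, U x -> {for x, continuous f}
  | n'.+1 => (forall x, U x -> differentiable f x) /\
             (forall k : 'I_2, Ck_on n' U (partial k f))
  end.

Definition smooth_on (R : realType) (U : set 'rV[R]_2) (f : 'rV[R]_2 -> R) :=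
  forall n, Ck_on n U f.

(* Smooth 2-manifolds *)

(* Only the values of [cmap] on [dom], and those of [cinv] on [cmap @` dom],
   are meaningful. *)
Record chart (R : realType) (M : topologicalType) := Chart {
  dom : set M;
  cmap : M -> 'rV[R]_2;
  cinv : 'rV[R]_2 -> M;
  open_dom : open dom;
  open_cmap_dom : open (cmap @` dom);
  cmapK : forall P, dom P -> cinv (cmap P) = P;
  cmap_continuous : forall P, dom P -> {for P, continuous cmap};
  cinv_continuous : forall x, (cmap @` dom) x -> {for x, continuous cinv}
}.

Definition transition (R : realType) (M : topologicalType) (c c' : chart R M)
  (l : 'I_2) : 'rV[R]_2 -> R := fun x => cmap c' (cinv c x) 0 l.

Record surface (R : realType) := Surface {
  points :> topologicalType;
  surface_hausdorff : hausdorff_space points;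
  surface_second_countable : @second_countable points;
  index : Type;
  atlas : index -> chart R points;
  atlas_cover : forall P, exists c, dom (atlas c) P;
  transition_smooth : forall (c c' : index) (l : 'I_2),
    smooth_on (cmap (atlas c) @` (dom (atlas c) `&` dom (atlas c')))
              (transition (atlas c) (atlas c') l)
}.

Definition coords (R : realType) (M : surface R) (c : index M) :
  set 'rV[R]_2 := cmap (atlas c) @` dom (atlas c).

Definition smooth_fun (R : realType) (M : surface R) (f : M -> R) :=
  forall c : index M, smooth_on (coords c) (f \o cinv (atlas c)).

(* Differential forms, through their expressions in the charts: for [x] in
   [coords c], a 1-form w reads w c x 0 0 dx_0 + w c x 0 1 dx_1 in the chart c,
   and a 2-form t reads t c x dx_0 /\ dx_1.  Values outside [coords c] are
   meaningless, hence the equality [eq_form2]. *)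

Definition form1 (R : realType) (M : surface R) :=
  index M -> 'rV[R]_2 -> 'rV[R]_2.

Definition form2 (R : realType) (M : surface R) :=
  index M -> 'rV[R]_2 -> R.

Definition eq_form2 (R : realType) (M : surface R) (s t : form2 M) :=
  forall (c : index M) (x : 'rV[R]_2), coords c x -> s c x = t c x.

(* The second conjunct says that the local expressions are related by
   pullback along the transition maps. *)
Definition smooth_form1 (R : realType) (M : surface R) (w : form1 M) :=
  (forall (c : index M) (k : 'I_2),
     smooth_on (coords c) (fun x => w c x 0 k)) /\
  (forall (c c' : index M) (P : M) (k : 'I_2),
     dom (atlas c) P -> dom (atlas c') P ->
     w c (cmap (atlas c) P) 0 k =
     \sum_(l < 2) w c' (cmap (atlas c') P) 0 l *
        partial k (transition (atlas c) (atlas c') l) (cmap (atlas c) P)).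

Definition differential (R : realType) (M : surface R) (f : M -> R) : form1 M :=
  fun c x => \row_k partial k (f \o cinv (atlas c)) x.

Definition wedge (R : realType) (M : surface R) (v w : form1 M) : form2 M :=
  fun c x => v c x 0 0 * w c x 0 1 - v c x 0 1 * w c x 0 0.

Definition ext_d (R : realType) (M : surface R) (w : form1 M) : form2 M :=
  fun c x => partial 0 (fun y => w c y 0 1) x - partial 1 (fun y => w c y 0 0) x.

Definition scale2 (R : realType) (M : surface R) (f : M -> R) (t : form2 M) :
  form2 M := fun c x => f (cinv (atlas c) x) * t c x.

(* Coframes, and the operators D^1, D^2 with df = D^1 f w1 + D^2 f w2 *)

Definition coframe (R : realType) (M : surface R) (w1 w2 : form1 M) :=
  [/\ smooth_form1 w1, smooth_form1 w2 &
      forall (c : index M) (x : 'rV[R]_2),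
        coords c x -> row_free (col_mx (w1 c x) (w2 c x))].

Definition coframe_components (R : realType) (M : surface R)
    (w1 w2 : form1 M) (f : M -> R) (P : M) : set (R * R) :=
  [set a | forall c : index M, dom (atlas c) P ->
     differential f c (cmap (atlas c) P) =
     a.1 *: w1 c (cmap (atlas c) P) + a.2 *: w2 c (cmap (atlas c) P)].

Definition coframe_D1 (R : realType) (M : surface R) (w1 w2 : form1 M)
  (f : M -> R) (P : M) : R := (xget (0, 0) (coframe_components w1 w2 f P)).1.

Definition coframe_D2 (R : realType) (M : surface R) (w1 w2 : form1 M)
  (f : M -> R) (P : M) : R := (xget (0, 0) (coframe_components w1 w2 f P)).2.

Lemma coframe_componentsP (R : realType) (M : surface R) (w1 w2 : form1 M)
    (f : M -> R) (c : index M) (P : M) :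
  coframe w1 w2 -> smooth_fun f -> dom (atlas c) P ->
  differential f c (cmap (atlas c) P) =
  coframe_D1 w1 w2 f P *: w1 c (cmap (atlas c) P) +
  coframe_D2 w1 w2 f P *: w2 c (cmap (atlas c) P).
Proof.
move=> [[_ w1E] [_ w2E] free] sf cP.
suff [a aP] : exists a, coframe_components w1 w2 f P a.
  have := @xgetPex _ (0, 0) (coframe_components w1 w2 f P).
  by move=> /(_ (ex_intro _ a aP)); apply.
have sub : (differential f c (cmap (atlas c) P) <=
    col_mx (w1 c (cmap (atlas c) P)) (w2 c (cmap (atlas c) P)))%MS.
  apply: submx_full; rewrite row_full_unit -row_free_unit.
  by apply: free; exists P.
have [u uE] := submxP sub.
exists (lsubmx u 0 0, rsubmx u 0 0) => c' c'P /=.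
rewrite -[u]hsubmxK mul_row_col [lsubmx u]mx11_scalar [rsubmx u]mx11_scalar in uE.
rewrite !mul_scalar_mx in uE.
apply/rowP => k.
have chain : differential f c' (cmap (atlas c') P) 0 k =
    \sum_(l < 2) differential f c (cmap (atlas c) P) 0 l *
        partial k (transition (atlas c') (atlas c) l) (cmap (atlas c') P).
  set x := cmap (atlas c') P.
  have inx : coords c' x by exists P.
  pose tau y := cmap (atlas c) (cinv (atlas c') y).
  have tauE : tau = fun y => \sum_(l < 2)
      transition (atlas c') (atlas c) l y *: (delta_mx 0 l : 'rV[R]_2).
    by apply/funext => y; rewrite [LHS]row_sum_delta.
  have dtr l : differentiable (transition (atlas c') (atlas c) l) x.
    have [+ _] := @transition_smooth _ M c' c l 1%N.
    by apply; exists P.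
  have tauE' : tau = \sum_(l < 2) (fun y =>
      transition (atlas c') (atlas c) l y *: (delta_mx 0 l : 'rV[R]_2)).
    by rewrite tauE; apply/funext => y; rewrite fct_sumE.
  have dtau : differentiable tau x.
    by rewrite tauE'; apply: differentiable_sum => l; exact: differentiableZl.
  have tx : tau x = cmap (atlas c) P by rewrite /tau /x cmapK.
  have df : differentiable (f \o cinv (atlas c)) (tau x).
    have [+ _] := sf c 1%N; apply; rewrite tx; by exists P.
  have near_eq : {near x, f \o cinv (atlas c') =1 (f \o cinv (atlas c)) \o tau}.
    have : \forall y \near x, dom (atlas c) (cinv (atlas c') y).
      apply: (cinv_continuous inx).
      by rewrite cmapK//; apply: open_nbhs_nbhs; split => //; exact: open_dom.
    by apply: filterS => y yc /=; rewrite /tau cmapK.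
  rewrite mxE /partial (near_eq_derive _ near_eq) deriveE; last first.
    exact: differentiable_comp.
  have dtauE : 'd tau x (delta_mx 0 k) = \sum_(l < 2)
      partial k (transition (atlas c') (atlas c) l) x *: (delta_mx 0 l : 'rV[R]_2).
    rewrite -deriveE// tauE' derive_sum; last first.
      by move=> l; apply: diff_derivable; exact: differentiableZl.
    apply: eq_bigr => l _; rewrite deriveE; last exact: differentiableZl.
    by rewrite diffZl//= /partial deriveE.
  rewrite diff_comp//= dtauE linear_sum; apply: eq_bigr => l _.
  by rewrite linearZ mxE /partial -tx -deriveE// [RHS]mulrC.
rewrite chain uE !mxE (w1E c' c P k)// (w2E c' c P k)//.
rewrite !mulr_sumr -big_split/=; apply: eq_bigr => l _.
by rewrite !mxE mulrDl !mulrA.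
Qed.

(* The moving equation *)

Definition table (T : Type) (t0 : T) (m n : nat) (rows : seq (seq T)) :
  'M[T]_(m, n) := \matrix_(i, j) nth t0 (nth [::] rows i) j.

Definition moving_R1 (R : realType) (I40 I31 I22 I13 I04 : R) : 'M[R]_3 :=
  table 0 3 3
  [:: [:: - I40 / 4 + 3 * I22 / 4 - 1 / 2; - I31 / 4 + I13 / 12;
          - I40 / 4 - I22 / 4 + 1 / 2];
      [:: I31 / 4 - I13 / 12; - I40 / 4 + 3 * I22 / 4 + 1 / 2;
          - I31 / 4 - I13 / 4];
      [:: 1; 0; - I40 / 2 + 3 * I22 / 2]].

Definition moving_R2 (R : realType) (I40 I31 I22 I13 I04 : R) : 'M[R]_3 :=
  table 0 3 3
  [:: [:: - I31 / 4 + 3 * I13 / 4; - I22 / 4 + I04 / 12 + 1 / 2;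
          - I31 / 4 - I13 / 4];
      [:: I22 / 4 - I04 / 12 + 1 / 2; - I31 / 4 + 3 * I13 / 4;
          - I22 / 4 - I04 / 4 + 1 / 2];
      [:: 0; 1; - I31 / 2 + 3 * I13 / 2]].

(* [moving_w i j] is w_{i+1,j+1} = R^1_{i+1,j+1} w1 + R^2_{i+1,j+1} w2. *)
Definition moving_w (R : realType) (M : surface R) (w1 w2 : form1 M)
    (I40 I31 I22 I13 I04 : M -> R) (i j : 'I_3) : form1 M :=
  fun c x => let P := cinv (atlas c) x in
    moving_R1 (I40 P) (I31 P) (I22 P) (I13 P) (I04 P) i j *: w1 c x +
    moving_R2 (I40 P) (I31 P) (I22 P) (I13 P) (I04 P) i j *: w2 c x.

Definition moving_Omega (R : realType) (M : surface R) (w1 w2 : form1 M)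
    (I40 I31 I22 I13 I04 : M -> R) : 'M[form1 M]_4 :=
  let w := moving_w w1 w2 I40 I31 I22 I13 I04 in
  let z : form1 M := fun _ _ => 0 in
  table z 4 4
  [:: [:: w 0 0; w 0 1; w 0 2; w1];
      [:: w 1 0; w 1 1; w 1 2; w2];
      [:: w 2 0; w 2 1; w 2 2; z];
      [:: z; z; z; z]].

Definition structure_form (R : realType) (M : surface R) (n : nat)
    (W : 'M[form1 M]_n) (i j : 'I_n) : form2 M :=
  fun c x => ext_d (W i j) c x + \sum_(k < n) wedge (W i k) (W k j) c x.

Definition structure_equation (R : realType) (M : surface R) (n : nat)
    (W : 'M[form1 M]_n) :=
  forall i j : 'I_n, eq_form2 (structure_form W i j) (fun _ _ => 0).

(* Main.v *)
(* Since the entries of R^1 and R^2 are affine in the invariants, the entry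
   a w1 + b w2 of Omega has exterior derivative
   (D^1 b - D^2 a) w1 /\ w2 + a dw1 + b dw2 with D^k a, D^k b read off the same
   affine formulas.  The last column of the structure equation is equivalent to
   dw1 = Y1 w1 /\ w2 and dw2 = Y2 w1 /\ w2; granting these, the (i, j) entry of
   the 3x3 block is a constant multiple of one of the four scalar conditions
   times w1 /\ w2, which vanishes nowhere. *)

Require Import Defs.
From HB Require Import structures.
From mathcomp Require Import all_boot all_order all_algebra.
From mathcomp Require Import all_classical all_reals all_analysis.
From mathcomp Require Import ring lra.

Import Order.TTheory GRing.Theory Num.Theory.
Import numFieldNormedType.Exports.

Local Open Scope classical_set_scope.
Local Open Scope ring_scope.

(* On 1-forms frozen at x: df = a1 v1 + a2 v2, so that a1 and a2 are the values
   of D^1 f and D^2 f. *)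
Definition has_components {R : realType} (v1 v2 x : 'rV[R]_2)
    (f : 'rV[R]_2 -> R) (a1 a2 : R) : Prop :=
  differentiable f x /\
  forall k : 'I_2, partial k f x = a1 * v1 0 k + a2 * v2 0 k.

(** * Calculus of components of differentials along a frozen coframe *)

Section Components.
Context {R : realType} {v1 v2 x : 'rV[R]_2}.
Local Notation comps := (has_components v1 v2 x).
Implicit Types f g : 'rV[R]_2 -> R.

Lemma has_components_cst (a : R) : comps (fun=> a) 0 0.
Proof.
split=> [|k]; first exact: differentiable_cst.
by rewrite /partial derive_cst !mul0r addr0.
Qed.

Lemma has_componentsD f g a1 a2 b1 b2 :
  comps f a1 a2 -> comps g b1 b2 ->
  comps (fun y => f y + g y) (a1 + b1) (a2 + b2).
Proof.
move=> [df fE] [dg gE]; split=> [|k]; first exact: differentiableD.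
rewrite /partial deriveD; try exact: diff_derivable.
by rewrite -!/(partial k _ x) fE gE; ring.
Qed.

Lemma has_componentsMr f a1 a2 (b : R) :
  comps f a1 a2 -> comps (fun y => f y * b) (a1 * b) (a2 * b).
Proof.
move=> [df fE].
have -> : (fun y => f y * b) = b *: f.
  by apply/funext => y; rewrite fctE /= mulrC.
split=> [|k]; first exact: differentiableZ.
rewrite /partial deriveZ; last exact: diff_derivable.
by rewrite -!/(partial k _ x) fE /GRing.scale /=; ring.
Qed.

(** Subtracting [F 0 0 0 0 0] removes the constant term, so what remains is the linear part of [F]
    applied to the components of the five functions. Thus [F] itself serves to differentiate, and no
    entry of the tables has to be differentiated separately. *)
Lemma has_components_affine {F : R -> R -> R -> R -> R -> R}
    {z ua ub uc ud ue : R} {f1 f2 f3 f4 f5 p1 p2 p3 p4 p5 q1 q2 q3 q4 q5} :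
  (forall a b c d e,
     F a b c d e = z + a * ua + b * ub + c * uc + d * ud + e * ue) ->
  comps f1 p1 q1 -> comps f2 p2 q2 -> comps f3 p3 q3 -> comps f4 p4 q4 ->
  comps f5 p5 q5 ->
  comps (fun y => F (f1 y) (f2 y) (f3 y) (f4 y) (f5 y))
    (F p1 p2 p3 p4 p5 - F 0 0 0 0 0) (F q1 q2 q3 q4 q5 - F 0 0 0 0 0).
Proof.
move=> FE c1 c2 c3 c4 c5.
have -> : (fun y => F (f1 y) (f2 y) (f3 y) (f4 y) (f5 y)) =
    (fun y => z + f1 y * ua + f2 y * ub + f3 y * uc + f4 y * ud + f5 y * ue).
  by apply/funext.
rewrite !FE.
set r := _ - _; set s := _ - _.
have -> : r = 0 + p1 * ua + p2 * ub + p3 * uc + p4 * ud + p5 * ue.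
  by rewrite /r; ring.
have -> : s = 0 + q1 * ua + q2 * ub + q3 * uc + q4 * ud + q5 * ue.
  by rewrite /s; ring.
do 5!(apply: has_componentsD; last exact: has_componentsMr).
exact: has_components_cst.
Qed.

End Components.

(** * Affine dependence of the coefficient tables on the invariants *)

Lemma ord3_ind (P : 'I_3 -> Prop) : P 0 -> P 1 -> P 2 -> forall i, P i.
Proof.
move=> P0 P1 P2 [[|[|[|//]]] i3].
- by rewrite (_ : Ordinal i3 = 0) //; exact: val_inj.
- by rewrite (_ : Ordinal i3 = 1) //; exact: val_inj.
- by rewrite (_ : Ordinal i3 = 2) //; exact: val_inj.
Qed.

(** An affine map is determined by its values at the origin and at the five unit vectors. Writing
    the slopes this way is uniform in [i] and [j], and has the shape that [has_components_affine]
    expects. *)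
Lemma moving_R1_affine {R : realType} (i j : 'I_3) (a b c d e : R) :
  let z := moving_R1 0 0 0 0 0 i j : R in
  moving_R1 a b c d e i j = z + a * (moving_R1 1 0 0 0 0 i j - z)
    + b * (moving_R1 0 1 0 0 0 i j - z) + c * (moving_R1 0 0 1 0 0 i j - z)
    + d * (moving_R1 0 0 0 1 0 i j - z) + e * (moving_R1 0 0 0 0 1 i j - z).
Proof.
by elim/ord3_ind: i; elim/ord3_ind: j => /=; rewrite /moving_R1 !mxE /=; field.
Qed.

Lemma moving_R2_affine {R : realType} (i j : 'I_3) (a b c d e : R) :
  let z := moving_R2 0 0 0 0 0 i j : R in
  moving_R2 a b c d e i j = z + a * (moving_R2 1 0 0 0 0 i j - z)
    + b * (moving_R2 0 1 0 0 0 i j - z) + c * (moving_R2 0 0 1 0 0 i j - z)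
    + d * (moving_R2 0 0 0 1 0 i j - z) + e * (moving_R2 0 0 0 0 1 i j - z).
Proof.
by elim/ord3_ind: i; elim/ord3_ind: j => /=; rewrite /moving_R2 !mxE /=; field.
Qed.

(** * Exterior derivatives and wedge products in a coframe *)

(** By the Leibniz rule the new terms are [da /\ w1 + db /\ w2]; [a1] and [b2] drop out since
    [w1 /\ w1 = w2 /\ w2 = 0]. *)
Lemma ext_d_combination {R : realType} {M : surface R} (w1 w2 : form1 M)
    (a b : Defs.index M -> 'rV[R]_2 -> R) (c : Defs.index M) (x : 'rV[R]_2)
    (a1 a2 b1 b2 : R) :
  (forall k, differentiable (fun y => w1 c y 0 k) x) ->
  (forall k, differentiable (fun y => w2 c y 0 k) x) ->
  has_components (w1 c x) (w2 c x) x (a c) a1 a2 ->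
  has_components (w1 c x) (w2 c x) x (b c) b1 b2 ->
  ext_d (fun c y => a c y *: w1 c y + b c y *: w2 c y) c x =
  (b1 - a2) * wedge w1 w2 c x + a c x * ext_d w1 c x + b c x * ext_d w2 c x.
Proof.
move=> dw1 dw2 [da aE] [db bE].
have partialE k l :
    partial k (fun y => (a c y *: w1 c y + b c y *: w2 c y) 0 l) x =
    (a1 * w1 c x 0 k + a2 * w2 c x 0 k) * w1 c x 0 l
    + a c x * partial k (fun y => w1 c y 0 l) x
    + (b1 * w1 c x 0 k + b2 * w2 c x 0 k) * w2 c x 0 l
    + b c x * partial k (fun y => w2 c y 0 l) x.
  have -> : (fun y => (a c y *: w1 c y + b c y *: w2 c y) 0 l) =
      a c * (fun y => w1 c y 0 l) + b c * (fun y => w2 c y 0 l).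
    by apply/funext => y; rewrite !mxE.
  rewrite /partial deriveD; [|exact/diff_derivable/differentiableM..].
  rewrite !deriveM; try exact: diff_derivable.
  by rewrite -!/(partial k _ x) aE bE /GRing.scale /=; ring.
by rewrite /ext_d !partialE /wedge; ring.
Qed.

Lemma wedge_combinationl {R : realType} {M : surface R} (w1 w2 v : form1 M)
    (a b : Defs.index M -> 'rV[R]_2 -> R) (c : Defs.index M) (x : 'rV[R]_2) :
  wedge (fun c y => a c y *: w1 c y + b c y *: w2 c y) v c x =
  a c x * wedge w1 v c x + b c x * wedge w2 v c x.
Proof. by rewrite /wedge !mxE; ring. Qed.

Lemma wedge_combination {R : realType} {M : surface R} (w1 w2 : form1 M)
    (a b a' b' : Defs.index M -> 'rV[R]_2 -> R) (c : Defs.index M)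
    (x : 'rV[R]_2) :
  wedge (fun c y => a c y *: w1 c y + b c y *: w2 c y)
        (fun c y => a' c y *: w1 c y + b' c y *: w2 c y) c x =
  (a c x * b' c x - b c x * a' c x) * wedge w1 w2 c x.
Proof. by rewrite /wedge !mxE; ring. Qed.

(** The wedge is the determinant of the coframe matrix. Row freeness gives a right inverse [B], so
    this determinant times that of [B] is 1. *)
Lemma coframe_wedge_neq0 {R : realType} {M : surface R} (w1 w2 : form1 M)
    (c : Defs.index M) (x : 'rV[R]_2) :
  coframe w1 w2 -> coords c x -> wedge w1 w2 c x != 0.
Proof.
move=> [_ _ free] /free/row_freeP[B AB1].
have ABE (i j : 'I_(1 + 1)) : col_mx (w1 c x) (w2 c x) i 0 * B 0 j
    + col_mx (w1 c x) (w2 c x) i 1 * B 1 j = (i == j)%:R.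
  have := congr1 (fun A : 'M[R]_2 => A i j) AB1.
  rewrite /= mxE [RHS]mxE !big_ord_recl big_ord0 addr0 => <-.
  by rewrite (_ : 1 = lift ord0 ord0) //; exact: val_inj.
have v1E (j : 'I_(1 + 1)) :
    w1 c x 0 0 * B 0 j + w1 c x 0 1 * B 1 j = (lshift 1 0 == j)%:R.
  by rewrite -ABE !col_mxEu.
have v2E (j : 'I_(1 + 1)) :
    w2 c x 0 0 * B 0 j + w2 c x 0 1 * B 1 j = (rshift 1 0 == j)%:R.
  by rewrite -ABE !col_mxEd.
have e11 : w1 c x 0 0 * B 0 0 + w1 c x 0 1 * B 1 0 = 1 by rewrite v1E.
have e12 : w1 c x 0 0 * B 0 1 + w1 c x 0 1 * B 1 1 = 0 by rewrite v1E.
have e21 : w2 c x 0 0 * B 0 0 + w2 c x 0 1 * B 1 0 = 0 by rewrite v2E.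
have e22 : w2 c x 0 0 * B 0 1 + w2 c x 0 1 * B 1 1 = 1 by rewrite v2E.
apply/eqP => W0; have := oner_neq0 R.
suff -> : (1 : R) = wedge w1 w2 c x * (B 0 0 * B 1 1 - B 0 1 * B 1 0).
  by rewrite W0 mul0r eqxx.
(* Write 1 as [1 * 1 - 0 * 0] and replace the four factors by the entries of the product with [B];
   multiplicativity of the determinant is then a ring identity. *)
rewrite -[LHS]mulr1 -[LHS]subr0 -[X in _ - X](mulr0 0).
rewrite -[X in X * _ - _]e11 -[X in _ * X - _]e22.
rewrite -[X in _ - X * _]e12 -[X in _ - _ * X]e21.
by rewrite /wedge; ring.
Qed.

(* E1, ..., E4 are the left-hand sides of the four scalar conditions, in the
   order of the theorem. *)
Definition compatibility_table {R : realType}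
    (a b c d e p40 p31 p22 p13 p04 q40 q31 q22 q13 q04 : R) : 'M[R]_3 :=
  let E1 := 36 * q31 - 36 * p22 - 12 * q13 + 12 * p04
     - 9 * a * c + 3 * a * e - 24 * b * d + 18 * c ^+ 2 - 3 * c * e
     + 8 * d ^+ 2 - e ^+ 2 - 18 * a - 36 * c - 18 * e in
  let E2 := 12 * q40 - 12 * p31 + 12 * q22 - 12 * p13
     - 3 * a * b - 23 * a * d + 18 * b * c + 5 * b * e - 6 * c * d + d * e
     + 48 * d in
  let E3 := 12 * q31 - 12 * p22 + 12 * q13 - 12 * p04
     - 3 * a * c - 7 * a * e - 16 * b * d + 18 * c ^+ 2 + 15 * c * e
     - 16 * d ^+ 2 + e ^+ 2 + 18 * a - 36 * c - 6 * e in
  let E4 := 12 * q40 - 12 * p31 - 36 * q22 + 36 * p13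
     - 3 * a * b + a * d + 6 * b * c + b * e + 6 * c * d - 3 * d * e in
  table 0 3 3 [:: [:: E4 / 48; E1 / 144; E2 / 48];
                  [:: - E1 / 144; E4 / 48; E3 / 48];
                  [:: 0; 0; E4 / 24]].

(** With [p] and [q] standing for the values of D^1 and D^2, the left side is the coefficient of
    [w1 /\ w2] in an entry of the 3x3 block: first D^1 b - D^2 a, then the wedge products, then
    [a dw1 + b dw2] with Y1 and Y2 inserted. It amounts to nine polynomial identities. *)
Lemma structure_coefficients {R : realType} (i j : 'I_3)
    (a b c d e p40 p31 p22 p13 p04 q40 q31 q22 q13 q04 : R) :
  let A := moving_R1 a b c d e in
  let B := moving_R2 a b c d e in
  (moving_R2 p40 p31 p22 p13 p04 i j - moving_R2 0 0 0 0 0 i j)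
  - (moving_R1 q40 q31 q22 q13 q04 i j - moving_R1 0 0 0 0 0 i j)
  + \sum_(k < 3) (A i k * B k j - B i k * A k j)
  + A i j * (2 * d / 3) + B i j * (a / 4 - c / 2 - e / 12) =
  compatibility_table a b c d e p40 p31 p22 p13 p04 q40 q31 q22 q13 q04 i j.
Proof.
move=> A B.
rewrite !big_ord_recr big_ord0 /A /B /moving_R1 /moving_R2 /compatibility_table.
by elim/ord3_ind: i; elim/ord3_ind: j; rewrite !mxE /=; field.
Qed.

(** The embedding [widen_ord] is the one produced by [big_ord_recr], so case splits on indices and
    expanded sums refer to the same 3x3 block. *)
Lemma ord_recr_ind (n : nat) (P : 'I_n.+1 -> Prop) :
  (forall i, P (widen_ord (leqnSn n) i)) -> P ord_max -> forall i, P i.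
Proof.
move=> Pw Pmax i; case: (unliftP ord_max i) => [j|] -> //.
by rewrite (_ : lift _ _ = widen_ord (leqnSn n) j) //; apply/val_inj/lift_max.
Qed.

(** * The entries of the structure equation *)

Section StructureEquation.
Context {R : realType} {M : surface R} {w1 w2 : form1 M}.
Context {I40 I31 I22 I13 I04 : M -> R}.
Hypothesis hw : coframe w1 w2.
Hypotheses (h40 : smooth_fun I40) (h31 : smooth_fun I31)
  (h22 : smooth_fun I22) (h13 : smooth_fun I13) (h04 : smooth_fun I04).
Local Notation D1 := (coframe_D1 w1 w2).
Local Notation D2 := (coframe_D2 w1 w2).
Local Notation Omega := (moving_Omega w1 w2 I40 I31 I22 I13 I04).
Local Notation w := (moving_w w1 w2 I40 I31 I22 I13 I04).
Local Notation wide := (widen_ord (leqnSn 3)).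
Let z : form1 M := fun _ _ => 0.

Lemma moving_Omega_wide (i j : 'I_3) : Omega (wide i) (wide j) = w i j.
Proof. by elim/ord3_ind: i; elim/ord3_ind: j; rewrite mxE. Qed.

(** The third row falls on the default value [z] of [nth], which is the zero entry of the last
    column. *)
Lemma moving_Omega_col (i : 'I_3) :
  Omega (wide i) ord_max = nth z [:: w1; w2] i.
Proof. by elim/ord3_ind: i; rewrite mxE. Qed.

Lemma moving_Omega_row (j : 'I_4) : Omega ord_max j = z.
Proof. by case: j => [[|[|[|[|//]]]] ?]; rewrite mxE. Qed.

Context {c : Defs.index M} {x : 'rV[R]_2}.
Hypothesis cx : coords c x.
Let P := cinv (atlas c) x.
Let A := moving_R1 (I40 P) (I31 P) (I22 P) (I13 P) (I04 P).
Let B := moving_R2 (I40 P) (I31 P) (I22 P) (I13 P) (I04 P).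
Let W := wedge w1 w2 c x.

Lemma ext_d0 : ext_d z c x = 0.
Proof.
have zE k : (fun y => z c y 0 k) = cst 0 by apply/funext => y; rewrite mxE.
by rewrite /ext_d /partial !zE !derive_cst subr0.
Qed.

Lemma structure_form_row (j : 'I_4) : structure_form Omega ord_max j c x = 0.
Proof.
rewrite /structure_form moving_Omega_row ext_d0 add0r big1 // => k _.
by rewrite moving_Omega_row /wedge !mxE !mul0r subr0.
Qed.

Lemma structure_form_col (i : 'I_3) :
  structure_form Omega (wide i) ord_max c x =
  ext_d (nth z [:: w1; w2] i) c x + (A i 1 - B i 0) * W.
Proof.
rewrite /structure_form moving_Omega_col !big_ord_recr big_ord0 /= add0r.
rewrite -!/(wide _) !moving_Omega_wide !moving_Omega_col moving_Omega_row.
rewrite !wedge_combinationl -/P -/A -/B.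
rewrite /W /wedge !mxE /=; ring.
Qed.

Lemma smooth_fun_components {f} : smooth_fun f ->
  has_components (w1 c x) (w2 c x) x (f \o cinv (atlas c)) (D1 f P) (D2 f P).
Proof.
move=> sf; case: (cx) => Q cQ xQ.
have PQ : P = Q by rewrite /P -xQ cmapK.
(* Order 1 is the first level of [Ck_on] that contains differentiability. *)
split=> [|k]; first by have [+ _] := sf c 1; exact.
have /rowP/(_ k) := coframe_componentsP hw sf cQ.
by rewrite PQ xQ !mxE.
Qed.

Lemma structure_form_wide (i j : 'I_3) :
  structure_form Omega (wide i) (wide j) c x =
  ((moving_R2 (D1 I40 P) (D1 I31 P) (D1 I22 P) (D1 I13 P) (D1 I04 P) i j
    - moving_R2 0 0 0 0 0 i j)
   - (moving_R1 (D2 I40 P) (D2 I31 P) (D2 I22 P) (D2 I13 P) (D2 I04 P) i j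
      - moving_R1 0 0 0 0 0 i j)
   + \sum_(k < 3) (A i k * B k j - B i k * A k j)) * W
  + A i j * ext_d w1 c x + B i j * ext_d w2 c x.
Proof.
have c40 := smooth_fun_components h40; have c31 := smooth_fun_components h31.
have c22 := smooth_fun_components h22; have c13 := smooth_fun_components h13.
have c04 := smooth_fun_components h04.
have [[sw1 _] [sw2 _] _] := hw.
have dwE := ext_d_combination w1 w2
  (fun c y => let P := cinv (atlas c) y in
     moving_R1 (I40 P) (I31 P) (I22 P) (I13 P) (I04 P) i j)
  (fun c y => let P := cinv (atlas c) y in
     moving_R2 (I40 P) (I31 P) (I22 P) (I13 P) (I04 P) i j) c x _ _ _ _
  (fun k => (sw1 c k 1).1 x cx) (fun k => (sw2 c k 1).1 x cx)
  (has_components_affine (moving_R1_affine i j) c40 c31 c22 c13 c04)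
  (has_components_affine (moving_R2_affine i j) c40 c31 c22 c13 c04).
rewrite /structure_form big_ord_recr /= moving_Omega_wide [X in X + _]dwE.
(* The last summand is a wedge with the zero bottom row, so only the 3x3 block contributes. *)
rewrite moving_Omega_row.
rewrite (eq_bigr (fun k => (A i k * B k j - B i k * A k j) * W)); last first.
  by move=> k _; rewrite !moving_Omega_wide wedge_combination.
by rewrite -mulr_suml /= -/P -/A -/B -/W /wedge /z !mxE; ring.
Qed.

Lemma structure_form_compatibility (i j : 'I_3) :
  ext_d w1 c x = 2 * I13 P / 3 * W ->
  ext_d w2 c x = (I40 P / 4 - I22 P / 2 - I04 P / 12) * W ->
  structure_form Omega (wide i) (wide j) c x =
  compatibility_table (I40 P) (I31 P) (I22 P) (I13 P) (I04 P)
    (D1 I40 P) (D1 I31 P) (D1 I22 P) (D1 I13 P) (D1 I04 P)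
    (D2 I40 P) (D2 I31 P) (D2 I22 P) (D2 I13 P) (D2 I04 P) i j * W.
Proof.
move=> dw1 dw2; rewrite structure_form_wide dw1 dw2 -structure_coefficients.
by rewrite -/A -/B [RHS]mulrDl [X in _ = X + _]mulrDl !mulrA.
Qed.

End StructureEquation.

(** * Equivalence of the structure equation with the compatibility system *)

Theorem theorem4p4 (R : realType) (M : surface R) (w1 w2 : form1 M)
  (I40 I31 I22 I13 I04 : M -> R)
  (hw : coframe w1 w2)
  (h40 : smooth_fun I40) (h31 : smooth_fun I31) (h22 : smooth_fun I22)
  (h13 : smooth_fun I13) (h04 : smooth_fun I04) :
  let D1 := coframe_D1 w1 w2 in
  let D2 := coframe_D2 w1 w2 in
  let Y1 := fun P : M => 2 * I13 P / 3 in
  let Y2 := fun P : M => I40 P / 4 - I22 P / 2 - I04 P / 12 in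
  structure_equation (moving_Omega w1 w2 I40 I31 I22 I13 I04) <->
  (forall P : M,
     36 * D2 I31 P - 36 * D1 I22 P - 12 * D2 I13 P + 12 * D1 I04 P
     - 9 * I40 P * I22 P + 3 * I40 P * I04 P - 24 * I31 P * I13 P
     + 18 * I22 P ^+ 2 - 3 * I22 P * I04 P + 8 * I13 P ^+ 2 - I04 P ^+ 2
     - 18 * I40 P - 36 * I22 P - 18 * I04 P = 0) /\
  (forall P : M,
     12 * D2 I40 P - 12 * D1 I31 P + 12 * D2 I22 P - 12 * D1 I13 P
     - 3 * I40 P * I31 P - 23 * I40 P * I13 P + 18 * I31 P * I22 P
     + 5 * I31 P * I04 P - 6 * I22 P * I13 P + I13 P * I04 P
     + 48 * I13 P = 0) /\
  (forall P : M,
     12 * D2 I31 P - 12 * D1 I22 P + 12 * D2 I13 P - 12 * D1 I04 P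
     - 3 * I40 P * I22 P - 7 * I40 P * I04 P - 16 * I31 P * I13 P
     + 18 * I22 P ^+ 2 + 15 * I22 P * I04 P - 16 * I13 P ^+ 2 + I04 P ^+ 2
     + 18 * I40 P - 36 * I22 P - 6 * I04 P = 0) /\
  (forall P : M,
     12 * D2 I40 P - 12 * D1 I31 P - 36 * D2 I22 P + 36 * D1 I13 P
     - 3 * I40 P * I31 P + I40 P * I13 P + 6 * I31 P * I22 P
     + I31 P * I04 P + 6 * I22 P * I13 P - 3 * I13 P * I04 P = 0) /\
  eq_form2 (ext_d w1) (scale2 Y1 (wedge w1 w2)) /\
  eq_form2 (ext_d w2) (scale2 Y2 (wedge w1 w2)).
Proof.
move=> D1 D2 Y1 Y2; split=> [S|[E1 [E2 [E3 [E4 [dw1 dw2]]]]]].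
- have dw1 : eq_form2 (ext_d w1) (scale2 Y1 (wedge w1 w2)).
    move=> c x cx; have := S (widen_ord (leqnSn 3) 0) ord_max c x cx.
    (* Here [A 0 1 - B 0 0] equals -Y1; in the next row [A 1 1 - B 1 0] equals -Y2. *)
    rewrite structure_form_col /scale2 /moving_R1 /moving_R2 !mxE /= => S0.
    by apply/eqP; rewrite -subr_eq0; apply/eqP; rewrite -[RHS]S0 /Y1; field.
  have dw2 : eq_form2 (ext_d w2) (scale2 Y2 (wedge w1 w2)).
    move=> c x cx; have := S (widen_ord (leqnSn 3) 1) ord_max c x cx.
    rewrite structure_form_col /scale2 /moving_R1 /moving_R2 !mxE /= => S1.
    by apply/eqP; rewrite -subr_eq0; apply/eqP; rewrite -[RHS]S1 /Y2; field.
  have T P (i j : 'I_3) :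
      compatibility_table (I40 P) (I31 P) (I22 P) (I13 P) (I04 P)
        (D1 I40 P) (D1 I31 P) (D1 I22 P) (D1 I13 P) (D1 I04 P)
        (D2 I40 P) (D2 I31 P) (D2 I22 P) (D2 I13 P) (D2 I04 P) i j = 0.
    (* The scalar conditions live at points of [M], the forms in charts: any chart around [P] will
       do, and there the factor [w1 /\ w2] can be cancelled. *)
    have [c cP] := atlas_cover P.
    have cx : coords c (cmap (atlas c) P) by exists P.
    have := S (widen_ord (leqnSn 3) i) (widen_ord (leqnSn 3) j) c _ cx.
    rewrite (structure_form_compatibility hw h40 h31 h22 h13 h04 cx) ?cmapK //.
    + move=> /eqP; rewrite mulf_eq0 (negPf (coframe_wedge_neq0 _ _ _ _ hw cx)).
      by rewrite orbF => /eqP.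
    + by rewrite dw1 // /scale2 cmapK.
    + by rewrite dw2 // /scale2 cmapK.
  split=> [P|]; first by have := T P 0 1; rewrite mxE /=; lra.
  split=> [P|]; first by have := T P 0 2; rewrite mxE /=; lra.
  split=> [P|]; first by have := T P 1 2; rewrite mxE /=; lra.
  by split=> // P; have := T P 0 0; rewrite mxE /=; lra.
- elim/ord_recr_ind => [i|]; last by move=> j c x _; exact: structure_form_row.
  elim/ord_recr_ind => [j|] c x cx.
    rewrite (structure_form_compatibility hw h40 h31 h22 h13 h04 cx).
    + have {}E1 := E1 (cinv (atlas c) x); have {}E2 := E2 (cinv (atlas c) x).
      have {}E3 := E3 (cinv (atlas c) x); have {}E4 := E4 (cinv (atlas c) x).
      rewrite /compatibility_table E1 E2 E3 E4 oppr0 !mul0r.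
      by elim/ord3_ind: i; elim/ord3_ind: j; rewrite mxE /= mul0r.
    + exact: dw1.
    + exact: dw2.
  rewrite structure_form_col; elim/ord3_ind: i => /=.
  + by rewrite dw1 // /scale2 /moving_R1 /moving_R2 !mxE /= /Y1; field.
  + by rewrite dw2 // /scale2 /moving_R1 /moving_R2 !mxE /= /Y2; field.
  (* Since w31 = w1 and w32 = w2, this entry is [w1 /\ w1 + w2 /\ w2 = 0], which imposes no
     condition. *)
  + by rewrite ext_d0 /moving_R1 /moving_R2 !mxE /=; ring.
Qed.
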